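(* Let $\Bbbk$ be a field and let $G$ be a finite, simple, connected, nontrivial graph with edge ideal $I(G)$. For any induced subgraph $H$ of $G$ without isolated vertices, let $\mathcal{I}(H)$ denote the set of vertices $v\in V(G)$ connected only to vertices in $H$ (that is, all of whose neighbors in $G$ lie in $V(H)$). Then the LCM lattice $\mathcal{L}_{I(G)}$ is complemented if and only if for every induced subgraph $H$ of $G$ without isolated vertices there exists some independent set $X\subseteq V(H)$ such that $\mathcal{I}(H)\subseteq N(X)$.
   Context: A graph is nontrivial if it has at least one edge. For a graph $G$ on vertex set $V(G)=\{1,\ldots,n\}$, $I(G)=(x_ix_j\mid\{i,j\}\in E(G))\subseteq\Bbbk[x_1,\ldots,x_n]$. For a set $X$ of vertices, $N(X)=\bigcup_{v\in X}N(v)$, where $N(v)$ is the set of vertices adjacent to $v$ in $G$. A set of vertices is independent if no two of its elements are adjacent. The LCM lattice $\mathcal{L}_I$ of a monomial ideal $I$ is the set of least common multiples of subsets of its minimal monomial generators (the lcm of the empty set is $1$), ordered by divisibility; it is a finite lattice with join lcm. A bounded lattice is complemented if for every $x$ there is $y$ with $x\wedge y=\hat 0$ and $x\vee y=\hat 1$.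
   Formalization: The set I(H) is taken to consist only of vertices outside V(H) all of whose neighbors lie in V(H); if vertices of H were included, the condition would fail for H = G for every G, although the LCM lattice of a single edge is complemented. *)

(* Defs.v *)
From HB Require Import structures.
From mathcomp Require Import all_boot all_order all_algebra.
From mathcomp Require Export mpoly.

Set Implicit Arguments.
Unset Strict Implicit.
Unset Printing Implicit Defensive.

Import GRing.Theory.
Local Open Scope ring_scope.

Section Order.
Variables (T : Type) (le : T -> T -> Prop) (L : T -> Prop).

Definition is_bottom (b : T) : Prop := L b /\ forall z, L z -> le b z.

Definition is_top (t : T) : Prop := L t /\ forall z, L z -> le z t.

(* Meets and joins are those of the poset L, not of the ambient type T. *)
Definition is_meet (x y m : T) : Prop :=
  [/\ L m, le m x, le m y & forall z, L z -> le z x -> le z y -> le z m].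

Definition is_join (x y j : T) : Prop :=
  [/\ L j, le x j, le y j & forall z, L z -> le x z -> le y z -> le j z].

Definition complemented : Prop :=
  exists b t, [/\ is_bottom b, is_top t &
    forall x, L x -> exists y, [/\ L y, is_meet x y b & is_join x y t]].

End Order.

Definition ideal_gen (R : comNzRingType) (S : R -> Prop) (p : R) : Prop :=
  exists s : seq (R * R),
    (forall u, u \in s -> S u.2) /\ p = \sum_(u <- s) u.1 * u.2.

Section MonomialIdeal.
Variables (n : nat) (k : fieldType).

(* The unique minimal set of monomial generators of a monomial ideal consists
   of the monomials of the ideal that are minimal for divisibility. *)
Definition min_mon_gen (I : {mpoly k[n]} -> Prop) (m : 'X_{1..n}) : Prop :=
  I 'X_[m] /\
  forall m' : 'X_{1..n}, I 'X_[m'] -> (m' <= m)%MM -> m' = m.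

(* The empty sequence gives the monomial 1, whose exponent vector is 0%MM. *)
Definition lcm_lattice (I : {mpoly k[n]} -> Prop) (m : 'X_{1..n}) : Prop :=
  exists s : seq 'X_{1..n},
    (forall g, g \in s -> min_mon_gen I g) /\
    m = \big[@mlcm n/0%MM]_(g <- s) g.

(* On exponent vectors, divisibility of monomials is the pointwise order. *)
Definition mon_dvd (m1 m2 : 'X_{1..n}) : Prop := (m1 <= m2)%MM.

Definition edge_ideal (e : rel 'I_n) : {mpoly k[n]} -> Prop :=
  ideal_gen (fun p : {mpoly k[n]} => exists i j, e i j /\ p = 'X_i * 'X_j).

End MonomialIdeal.

Arguments edge_ideal {n} k e.

(* An induced subgraph is given by its vertex set W. *)
Section Graph.
Variables (V : finType) (e : rel V).

Definition no_isolated (W : {set V}) : Prop :=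
  forall v, v \in W -> exists2 w, w \in W & e v w.

Definition neighbours (X : {set V}) : {set V} :=
  [set w | [exists v in X, e v w]].

Definition independent (X : {set V}) : Prop :=
  forall v w, v \in X -> w \in X -> ~~ e v w.

(* The vertices outside W all of whose neighbours lie in W.  Vertices of W are
   excluded: for W the whole vertex set of a nonempty graph, they could not be
   covered by the open neighbourhood of an independent set. *)
Definition connected_only_to (W : {set V}) : {set V} :=
  [set v | (v \notin W) && [forall w, e v w ==> (w \in W)]].

End Graph.

(* Main.v *)
Require Import Defs.
From mathcomp Require Import all_boot all_order all_algebra.

(** Least common multiples of edges are squarefree monomials, so the LCM
    lattice is the poset of vertex sets [W] without isolated vertices, with
    union as join; [W] and [Y] meet in the empty set iff no edge lies inside
    [W :&: Y].  A complement [Y] of [W] thus contains [~: W] and has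
    [X := W :&: Y] independent, and a vertex all of whose neighbours lie in [W]
    can only be non-isolated in [Y] thanks to [X].  Conversely [~: W] together
    with the vertices of [X] adjacent to [~: W] is a complement. *)

Set Implicit Arguments.
Unset Strict Implicit.
Unset Printing Implicit Defensive.

Import GRing.Theory.
Local Open Scope ring_scope.

Section SquarefreeMonomials.
Variable n : nat.
Implicit Types (W : {set 'I_n}) (m : 'X_{1..n}).

Definition mnm_set W : 'X_{1..n} := [multinom (i \in W : nat) | i < n].

Lemma mnm_setE W i : mnm_set W i = (i \in W).
Proof. exact: mnmE. Qed.

Lemma mnm_set_leP W m :
  reflect (forall i, i \in W -> (0 < m i)%N) (mnm_set W <= m)%MM.
Proof.
apply: (iffP mnm_lepP) => [le_m i iW | le_m i]; first by have := le_m i; rewrite mnm_setE iW.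
by rewrite mnm_setE; case: (boolP (i \in W)) => // /le_m.
Qed.

Lemma mnm_set_le W W' : (mnm_set W <= mnm_set W')%MM = (W \subset W').
Proof.
apply/mnm_set_leP/subsetP => sub i /sub; by rewrite mnm_setE lt0b.
Qed.

Lemma mnm_set0 : mnm_set set0 = 0%MM.
Proof. by apply/mnmP=> i; rewrite mnm_setE inE mnm0E. Qed.

Lemma mnm_setU W W' : mlcm (mnm_set W) (mnm_set W') = mnm_set (W :|: W').
Proof.
by apply/mnmP=> i; rewrite mnmE !mnm_setE inE; case: (_ \in W); case: (_ \in W').
Qed.

Lemma mnm_set2 i j : i != j -> mnm_set [set i; j] = (U_(i) + U_(j))%MM.
Proof.
move=> ij; apply/mnmP=> l; rewrite mnm_setE mnmDE !mnm1E !inE ![l == _]eq_sym.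
by case: (eqVneq i l) => [<-|_] //=; rewrite eq_sym (negPf ij).
Qed.

End SquarefreeMonomials.

Lemma mcoeffMX_neq0_le (R : nzRingType) (n : nat) (p : {mpoly R[n]})
    (m m' : 'X_{1..n}) : (p * 'X_[m])@_m' != 0 -> (m <= m')%MM.
Proof.
by rewrite -mcoeff_msupp (perm_mem (msuppMX p m)) => /mapP[l _ ->]; apply: lem_addr.
Qed.

Section EdgeIdeal.
Variables (k : fieldType) (n : nat) (e : rel 'I_n).
Hypothesis e_irr : irreflexive e.
Implicit Types (W : {set 'I_n}) (m : 'X_{1..n}).

Lemma edge_neq i j : e i j -> i != j.
Proof. by apply: contraTneq => ->; rewrite e_irr. Qed.

(** A monomial ideal contains ['X_[m]] only if one generator divides it: when ['X_[m]] is a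
    combination of generators, some summand has a nonzero coefficient at [m], and every monomial of
    that summand is a multiple of its generator. *)
Lemma edge_idealXP m :
  edge_ideal k e 'X_[m] <->
  exists i j, e i j /\ (mnm_set [set i; j] <= m)%MM.
Proof.
split=> [[s [s_edge Xm]] | [i [j [eij le_m]]]].
  have /hasP[[p q] ps /= nz] : has (fun u => (u.1 * u.2)@_m != 0) s.
    apply: contraT => /hasPn s0; have := oner_neq0 k.
    (* The unit is read as the coefficient of ['X_[m]] at [m], which would be a sum of zeros. *)
    rewrite -[1]/(true%:R) -(eqxx m) -mcoeffX Xm raddf_sum /= big_seq big1 ?eqxx //.
    by move=> u /s0; rewrite negbK => /eqP.
  have [i [j [eij /= q_def]]] := s_edge _ ps.
  exists i, j; split=> //; rewrite mnm_set2 ?edge_neq //.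
  by apply: (@mcoeffMX_neq0_le _ _ p); rewrite mpolyXD -q_def.
exists [:: ('X_[m - mnm_set [set i; j]], 'X_i * 'X_j)]; split.
  by move=> u; rewrite inE => /eqP->; exists i, j.
by rewrite big_seq1 /= -!mpolyXD -mnm_set2 ?edge_neq // submK.
Qed.

(** Edges all have exactly two vertices, as [e] is irreflexive, so no edge monomial properly divides
    another. *)
Lemma min_mon_gen_edgeP m :
  min_mon_gen (edge_ideal k e) m <->
  exists i j, e i j /\ m = mnm_set [set i; j].
Proof.
split=> [[/edge_idealXP[i [j [eij le_m]]] m_min] | [i [j [eij ->]]]].
  exists i, j; split=> //; apply/esym/m_min => //.
  by apply/edge_idealXP; exists i, j; split=> //; apply: lepm_refl.
split; first by apply/edge_idealXP; exists i, j; split=> //; apply: lepm_refl.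
move=> m' /edge_idealXP[i' [j' [e'ij le_m']]] m'_le.
have := lepm_trans le_m' m'_le; rewrite mnm_set_le => sub.
have eq_ij : [set i'; j'] = [set i; j].
  by apply/eqP; rewrite eqEcard sub !cards2 !edge_neq.
(* [m'] is squeezed between the monomials of two equal edges. *)
apply/mnmP=> l; apply/eqP; rewrite eqn_leq (mnm_lepP m'_le) /=.
by rewrite -eq_ij (mnm_lepP le_m').
Qed.

Lemma lcm_edgesP (s : seq 'X_{1..n}) :
  (forall g, g \in s -> exists i j, e i j /\ g = mnm_set [set i; j]) ->
  symmetric e ->
  exists2 W, no_isolated e W & \big[@mlcm n/0%MM]_(g <- s) g = mnm_set W.
Proof.
move=> + e_sym; elim: s => [|g s IHs] s_edge.
  by exists set0; [move=> v; rewrite inE | rewrite big_nil mnm_set0].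
have [|W W_iso W_def] := IHs; first by move=> h hs; apply: s_edge; rewrite inE hs orbT.
have [|i [j [eij g_def]]] := s_edge g; first exact: mem_head.
exists ([set i; j] :|: W); last by rewrite big_cons W_def g_def mnm_setU.
move=> v; rewrite !inE => /orP[/orP[]/eqP->|/W_iso[w wW evw]].
- by exists j; rewrite ?inE ?eqxx ?orbT.
- by exists i; rewrite ?inE ?eqxx // e_sym.
- by exists w; rewrite ?inE ?wW ?orbT.
Qed.

Lemma biglcm_le (s : seq 'X_{1..n}) m :
  (\big[@mlcm n/0%MM]_(g <- s) g <= m)%MM = all (fun g => g <= m)%MM s.
Proof.
elim: s => [|g s IHs]; last by rewrite big_cons lem_mlcm IHs.
by rewrite big_nil /=; apply/mnm_lepP=> i; rewrite mnm0E.
Qed.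

(** A set without isolated vertices is the union of the edges inside it; conversely every vertex of
    a union of edges keeps a neighbour there. *)
Lemma lcm_lattice_edgeP m : symmetric e ->
  lcm_lattice (edge_ideal k e) m <->
  exists2 W, no_isolated e W & m = mnm_set W.
Proof.
move=> e_sym; split=> [[s [s_gen ->]] | [W W_iso ->]].
  by apply: lcm_edgesP => // g /s_gen /min_mon_gen_edgeP.
pose s := [seq mnm_set [set u.1; u.2] |
             u <- enum [pred u : 'I_n * 'I_n | [&& e u.1 u.2, u.1 \in W & u.2 \in W]]].
exists s; split=> [g /mapP[[i j]] | ].
  rewrite mem_enum => /and3P[/= eij _ _] ->.
  by apply/min_mon_gen_edgeP; exists i, j.
have W_le : (mnm_set W <= \big[@mlcm n/0%MM]_(g <- s) g)%MM.
  apply/mnm_set_leP=> i iW; have [j jW eij] := W_iso i iW.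
  (* Through [biglcm_le], reflexivity says that each member of [s] divides the lcm. *)
  have := lepm_refl (\big[@mlcm n/0%MM]_(g <- s) g).
  rewrite biglcm_le => /allP/(_ (mnm_set [set i; j])) le_s.
  have /mnm_set_leP-> // : (mnm_set [set i; j] <= \big[@mlcm n/0%MM]_(g <- s) g)%MM.
    apply: le_s; apply/mapP; exists (i, j) => //.
    by rewrite mem_enum; apply/and3P; split.
  by rewrite !inE eqxx.
have le_W : (\big[@mlcm n/0%MM]_(g <- s) g <= mnm_set W)%MM.
  rewrite biglcm_le; apply/allP=> _ /mapP[[i j] + ->].
  rewrite mem_enum => /and3P[/= _ iW jW].
  by rewrite mnm_set_le; apply/subsetP=> l; rewrite !inE => /orP[]/eqP->.
apply/mnmP=> i; apply/eqP.
by rewrite eqn_leq (mnm_lepP W_le) (mnm_lepP le_W).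
Qed.

(** Since every vertex has a neighbour, [setT] is in the lattice and is its top. The meet can be
    smaller than the intersection: it is the bottom as soon as [W :&: Y] contains no edge. *)
Lemma complemented_edgeP :
  symmetric e -> (forall v, exists w, e v w) ->
  complemented (@mon_dvd n) (lcm_lattice (edge_ideal k e)) <->
  forall W, no_isolated e W -> exists Y,
    [/\ no_isolated e Y, W :|: Y = setT & independent e (W :&: Y)].
Proof.
move=> e_sym e_tot; rewrite /complemented /mon_dvd.
set L := lcm_lattice _.
have LP m := lcm_lattice_edgeP m e_sym.
have L_set W : no_isolated e W -> L (mnm_set W) by move=> ?; apply/LP; exists W.
have iso0 : no_isolated e set0 by move=> v; rewrite inE.
have isoT : no_isolated e setT.
  by move=> v _; have [w evw] := e_tot v; exists w; rewrite ?inE.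
split=> [[b [t [[Lb b_min] [Lt t_max] compl]]] W W_iso | compl].
  have [_ [/LP[Y Y_iso ->]]] := compl _ (L_set _ W_iso).
  move=> [_ _ _ meet_max] [_ _ _ join_min]; exists Y; split=> //.
    (* The top [t] dominates [setT], and as the join it lies below the upper bound [W :|: Y]. *)
    apply/eqP; rewrite -subTset -mnm_set_le; apply: lepm_trans (t_max _ _) _.
      exact: L_set.
    apply: join_min; rewrite ?mnm_set_le ?subsetUl ?subsetUr //.
    apply: L_set => v; rewrite inE => /orP[/W_iso|/Y_iso] [w wW evw];
      by exists w; rewrite // inE wW ?orbT.
  move=> v w /setIP[vW vY] /setIP[wW wY]; apply/negP=> evw.
  (* An edge inside [W :&: Y] is itself a lattice element below both, hence below [b] and so below
     the empty set. *)
  have vw_iso : no_isolated e [set v; w].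
    by move=> u /set2P[]->; [exists w | exists v]; rewrite ?inE ?eqxx ?orbT // e_sym.
  have vw_le : (mnm_set [set v; w] <= b)%MM.
    apply: meet_max; rewrite ?mnm_set_le; first exact: L_set.
      by apply/subsetP=> u /set2P[]->.
    by apply/subsetP=> u /set2P[]->.
  have := lepm_trans vw_le (b_min _ (L_set _ iso0)).
  by rewrite mnm_set_le => /subsetP/(_ v); rewrite !inE eqxx => /(_ isT).
have le_T m : L m -> (m <= mnm_set setT)%MM.
  by move=> /LP[W _ ->]; rewrite mnm_set_le subsetT.
have ge_0 m : L m -> (mnm_set set0 <= m)%MM.
  by move=> /LP[W _ ->]; rewrite mnm_set_le sub0set.
exists (mnm_set set0), (mnm_set setT); split.
- by split; [apply: L_set | ].
- by split; [apply: L_set | ].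
move=> _ /LP[W W_iso ->]; have [Y [Y_iso WY_cover WY_indep]] := compl W W_iso.
exists (mnm_set Y); split; first exact: L_set.
- split; [exact: L_set | exact/ge_0/L_set | exact/ge_0/L_set |].
  move=> _ /LP[Z Z_iso ->]; rewrite !mnm_set_le => ZW ZY.
  have /subsetP ZWY : Z \subset W :&: Y by rewrite subsetI ZW.
  apply/subsetP=> v vZ; have [w wZ evw] := Z_iso v vZ.
  by have := WY_indep v w (ZWY v vZ) (ZWY w wZ); rewrite evw.
- split; [exact: L_set | exact/le_T/L_set | exact/le_T/L_set |].
  move=> _ /LP[Z _ ->]; rewrite !mnm_set_le => WZ YZ.
  by rewrite -WY_cover subUset WZ.
Qed.

End EdgeIdeal.

Lemma set_complement_iff_cover (V : finType) (e : rel V) (W : {set V}) :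
  symmetric e ->
  (exists Y, [/\ no_isolated e Y, W :|: Y = setT & independent e (W :&: Y)]) <->
  (exists X : {set V}, [/\ X \subset W, independent e X &
                 connected_only_to e W \subset neighbours e X]).
Proof.
move=> e_sym; split=> [[Y [Y_iso WY_cover WY_indep]] | [X [XW X_indep X_cover]]].
  exists (W :&: Y); split=> //; first exact: subsetIl.
  apply/subsetP=> v; rewrite !inE => /andP[vW /forallP vNW].
  have vY : v \in Y.
    by have := in_setT v; rewrite -WY_cover inE (negPf vW).
  have [w wY evw] := Y_iso v vY.
  apply/existsP; exists w; rewrite inE wY andbT e_sym evw andbT.
  by have /implyP-> := vNW w.
(* The other vertices of [X] are dropped: having no neighbour outside [W] and none in the
   independent set [X], they would be isolated in the complement. *)
pose X' := [set x in X | [exists v, (v \notin W) && e x v]].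
have WX' : W :&: (~: W :|: X') = X'.
  apply/setP=> v; rewrite !inE; case: (boolP (v \in W)) => //= vW.
  by rewrite (contraNF (subsetP XW v)).
exists (~: W :|: X'); split.
- move=> v; rewrite !inE => /orP[vW | /andP[vX /existsP[w /andP[wW evw]]]]; last first.
    by exists w; rewrite // !inE wW.
  (* A vertex [v] outside [W] with all neighbours in [W] has a neighbour [x] in [X], and [v] itself
     witnesses that [x] is in [X']. Any other [v] outside [W] has a neighbour outside [W]. *)
  case: (boolP (v \in connected_only_to e W)) => [/(subsetP X_cover) | ].
    rewrite inE => /existsP[x /andP[xX exv]]; exists x; last by rewrite e_sym.
    by rewrite !inE xX; apply/orP; right; apply/existsP; exists v; rewrite vW.
  rewrite inE vW /= negb_forall => /existsP[w]; rewrite negb_imply => /andP[evw wW].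
  by exists w; rewrite // !inE wW.
- by rewrite setUA setUCr setTU.
- by rewrite WX' => v w; rewrite !inE => /andP[vX _] /andP[wX _]; apply: X_indep.
Qed.

(** The first edge of a path from [v] to some other vertex gives the neighbour; the endpoint [a] of
    the given edge is such a vertex unless [a] is [v], and then [b] is the neighbour. *)
Lemma connected_nontrivial_edge (V : finType) (e : rel V) :
  (forall u v, connect e u v) -> (exists u v, e u v) ->
  forall v, exists w, e v w.
Proof.
move=> e_conn [a [b eab]] v.
have step u : u != v -> exists w, e v w.
  have /connectP[[|w p] /= + ->] := e_conn v u; first by rewrite eqxx.
  by case/andP=> evw _ _; exists w.
case: (eqVneq a v) => [<-|/step //]; by exists b.
Qed.

Theorem proposition6p8 (k : fieldType) (n : nat) (e : rel 'I_n)
    (e_sym : symmetric e) (e_irr : irreflexive e)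
    (e_conn : forall u v : 'I_n, connect e u v)
    (e_nontriv : exists u v : 'I_n, e u v) :
  complemented (@mon_dvd n) (lcm_lattice (edge_ideal k e)) <->
  (forall W : {set 'I_n}, no_isolated e W ->
     exists X : {set 'I_n},
       [/\ X \subset W, independent e X &
           connected_only_to e W \subset neighbours e X]).
Proof.
have e_tot := connected_nontrivial_edge e_conn e_nontriv.
have complP := complemented_edgeP k e_irr e_sym e_tot.
split=> [/complP | ] compl; first by move=> W /compl /(set_complement_iff_cover W e_sym).
by apply/complP=> W /compl /(set_complement_iff_cover W e_sym).
Qed.
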